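(* Let $(A,[\cdot,\cdot])$ be a Malcev superalgebra, $\rho:A\to gl(V)$ a representation of $A$, and $\rho^*:A\to gl(V^* )$ its dual representation. Let $T:V\to A$ be a linear map with $|T|=0$ (i.e. even), identified with an element of $A\otimes V^*\subset(A\ltimes_{\rho^*}V^* )\otimes(A\ltimes_{\rho^*}V^* )$. Then $T$ is a super $\mathcal O$-operator of $A$ associated to $(V,\rho)$ if and only if $r=T-\sigma(T)$ is a skew-supersymmetric solution of the super Malcev Yang-Baxter equation in $A\ltimes_{\rho^*}V^*$.
   Context: All vector spaces are finite dimensional over an algebraically closed field $\mathbb K$ of characteristic zero. A super vector space is a $\mathbb Z_2$-graded space; $|x|$ is the parity of a homogeneous element. A Malcev superalgebra is a super vector space $A$ with a bilinear map $[\cdot,\cdot]$, $[A_\alpha,A_\beta]\subseteq A_{\alpha+\beta}$, such that for all homogeneous $x,y,z,t$: $[x,y]=-(-1)^{|x||y|}[y,x]$ and $$(-1)^{|y||z|}[[x,z],[y,t]]=[[[x,y],z],t]+(-1)^{|x|(|y|+|z|+|t|)}[[[y,z],t],x]+(-1)^{(|x|+|y|)(|z|+|t|)}[[[z,t],x],y]+(-1)^{|t|(|x|+|y|+|z|)}[[[t,x],y],z].$$ A representation of $A$ on a super vector space $V$ is an even linear map $\rho:A\to gl(V)$ with, for all homogeneous $x,y,z\in A$, $$\rho([[x,y],z])=\rho(x)\rho(y)\rho(z)-(-1)^{|z|(|x|+|y|)}\rho(z)\rho(x)\rho(y)+(-1)^{|x|(|y|+|z|)}\rho(y)\rho([z,x])-(-1)^{|x|(|y|+|z|)}\rho([y,z])\rho(x).$$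 $V^*$ is graded by $V^*_\alpha=\{a^*:a^*(V_{\alpha+\bar1})=0\}$, with canonical pairing $\langle a^*,b\rangle=a^*(b)$. The dual representation is $\langle\rho^*(x)a^*,b\rangle=-(-1)^{|x||a^*|}\langle a^*,\rho(x)b\rangle$. The semi-direct product $A\ltimes_{\rho^*}V^*$ is the Malcev superalgebra $A\oplus V^*$ with bracket $[x+a^*,y+b^*]=[x,y]+\rho^*(x)b^*-(-1)^{|x||y|}\rho^*(y)a^*$, for homogeneous $x+a^*$, $y+b^*$ (so $|x|=|a^*|$, $|y|=|b^*|$). A super $\mathcal O$-operator of $A$ associated to $(V,\rho)$ is an even linear map $T:V\to A$ with $[T(a),T(b)]=T(\rho(T(a))b-(-1)^{|a||b|}\rho(T(b))a)$ for all homogeneous $a,b\in V$. Identification: if $\{w_i\}$ is a homogeneous basis of $V$ with dual basis $\{w_i^*\}$ (i.e. $\langle w_i^*,w_j\rangle=\delta_{ij}$), $T$ is identified with $\sum_i T(w_i)\otimes w_i^*$. The flip is $\sigma(x\otimes y)=(-1)^{|x||y|}y\otimes x$, and $r$ is skew-supersymmetric if $r=-\sigma(r)$. For an even tensor $r=\sum_i x_i\otimes y_i$ ($x_i,y_i$ homogeneous, $|x_i|=|y_i|$) over a Malcev superalgebra, the super Malcev Yang-Baxter equation is $[r_{12},r_{13}]+[r_{12},r_{23}]+[r_{13},r_{23}]=0$, where $[r_{12},r_{13}]=\sum_{i,j}(-1)^{|x_j||y_i|}[x_i,x_j]\otimes y_i\otimes y_j$, $[r_{12},r_{23}]=\sum_{i,j}x_i\otimes[y_i,x_j]\otimes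 y_j$, $[r_{13},r_{23}]=\sum_{i,j}(-1)^{|x_j||y_i|}x_i\otimes x_j\otimes[y_i,y_j]$. *)

(* Defs.v *)
From HB Require Import structures.
From mathcomp Require Import all_boot all_order all_algebra.

Set Implicit Arguments.
Unset Strict Implicit.
Unset Printing Implicit Defensive.

Import GRing.Theory VectorInternalTheory.

Local Open Scope ring_scope.

(* Parities are booleans: false is the even degree, true the odd one, (+) is  *)
(* addition in Z/2, and a bool in an exponent is coerced to 0 or 1.           *)

Record superspace (K : fieldType) := Superspace {
  svect :> vectType K;
  part : bool -> {vspace svect};
  part_direct : directv (part false + part true);
  part_full : (part false + part true = fullv)%VS
}.

Section BilinearMaps.

Variable K : fieldType.

Definition is_bilinear (U V W : lmodType K) (F : U -> V -> W) : Prop :=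
  (forall y, linear (F^~ y)) /\ (forall x, linear (F x)).

(* The element of 'Hom(U, 'Hom(V, W)) given by a bilinear function. *)
Definition bilin (U V W : vectType K) (F : U -> V -> W) : 'Hom(U, 'Hom(V, W)) :=
  linfun (fun x => linfun (F x)).

Lemma linfunE (U V : vectType K) (f : U -> V) (x : U) :
  linear f -> linfun f x = f x.
Proof.
move=> flin; pose f' : {linear U -> V} :=
  HB.pack f (GRing.isLinear.Build K U V *:%R f flin).
exact: (lfunE f' x).
Qed.

Lemma bilinE (U V W : vectType K) (F : U -> V -> W) x y :
  is_bilinear F -> bilin F x y = F x y.
Proof.
move=> [Fl Fr]; rewrite /bilin linfunE ?linfunE // => k u v.
by apply/lfunP=> z; rewrite !lfun_simp !linfunE // Fl.
Qed.

End BilinearMaps.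

Section SuperSpaces.

Variable K : fieldType.
Implicit Types U V W : superspace K.

Definition parity_proj V (a : bool) : 'End(V) :=
  daddv_pi (part V a) (part V (~~ a)).

Lemma part_cap V a : (part V a :&: part V (~~ a) = 0)%VS.
Proof.
by case: a; [rewrite capvC|]; apply/directv_addP/part_direct.
Qed.

Lemma part_add V a : (part V a + part V (~~ a) = fullv)%VS.
Proof. by case: a; [rewrite addvC|]; apply: part_full. Qed.

Lemma mem_parity_proj V a x : parity_proj V a x \in part V a.
Proof. exact: memv_pi. Qed.

Lemma parity_proj_id V a x : x \in part V a -> parity_proj V a x = x.
Proof. by move=> xa; rewrite /parity_proj daddv_pi_id ?part_cap. Qed.

Lemma parity_proj_sum V x : parity_proj V false x + parity_proj V true x = x.
Proof. by apply: daddv_pi_add; rewrite ?part_cap ?part_add ?memvf. Qed.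

Lemma parity_proj_neq V a b x :
  x \in part V b -> a != b -> parity_proj V a x = 0.
Proof.
move=> xb ab; have -> : a = ~~ b by case: a b ab {xb} => -[].
apply: (@addrI _ (parity_proj V b x)); rewrite addr0.
rewrite [RHS]parity_proj_id // -[RHS]parity_proj_sum.
by case: b {xb ab}; rewrite // addrC.
Qed.

(* The bilinear map determined by a formula f a b x y that makes sense for x  *)
(* of parity a and y of parity b.                                             *)
Definition homext U V (W : vectType K) (f : bool -> bool -> U -> V -> W)
    (x : U) (y : V) : W :=
  \sum_(a : bool) \sum_(b : bool) f a b (parity_proj U a x) (parity_proj V b y).

Lemma homext_bilinear U V (W : vectType K) (f : bool -> bool -> U -> V -> W) :
  (forall a b, is_bilinear (f a b)) -> is_bilinear (homext f).
Proof.
move=> fbil; split=> [y | x] k u v; rewrite /homext scaler_sumr -big_split /=;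
  apply: eq_bigr => a _; rewrite scaler_sumr -big_split /=; apply: eq_bigr => b _;
  have [fl fr] := fbil a b; by rewrite linearP ?fl ?fr.
Qed.

Lemma homextE U V (W : vectType K) (f : bool -> bool -> U -> V -> W) a b x y :
    (forall a b, is_bilinear (f a b)) -> x \in part U a -> y \in part V b ->
  homext f x y = f a b x y.
Proof.
move=> fbil xa yb.
have f0l c d z : f c d 0 z = 0.
  by have [+ _] := fbil c d => /(_ z (-1) 0 0); rewrite scaler0 addr0 scaleN1r addNr.
have f0r c d z : f c d z 0 = 0.
  by have [_ +] := fbil c d => /(_ z (-1) 0 0); rewrite scaler0 addr0 scaleN1r addNr.
rewrite /homext (bigD1 a) //= [X in _ + X]big1 ?addr0 => [|c ca]; last first.
  by apply: big1 => d _; rewrite (parity_proj_neq xa ca) f0l.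
rewrite (bigD1 b) //= big1 ?addr0 => [|d db]; first by rewrite !parity_proj_id.
by rewrite (parity_proj_neq yb db) f0r.
Qed.

Definition even_map U V (T : 'Hom(U, V)) : Prop :=
  forall a x, x \in part U a -> T x \in part V a.

(* A map into the bilinear maps that adds parities; with W = V this says that *)
(* U -> gl(V) is even for the usual grading of gl(V).                         *)
Definition even_bilin U V W (F : 'Hom(U, 'Hom(V, W))) : Prop :=
  forall a b x y, x \in part U a -> y \in part V b -> F x y \in part W (a (+) b).

Definition homogeneous_basis V n (w : n.-tuple V) : Prop :=
  basis_of fullv w /\ forall i : 'I_n, exists a, w`_i \in part V a.

Lemma superspace_direct (V : vectType K) (P : bool -> {vspace V}) :
  (forall v, v \in P false -> v \in P true -> v = 0) ->
  directv (P false + P true).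
Proof.
move=> P0; apply/directv_addP/eqP; rewrite -subv0; apply/subvP=> v.
by rewrite memv_cap memv0 => /andP[v0 v1]; apply/eqP/P0.
Qed.

Lemma superspace_full (V : vectType K) (P : bool -> {vspace V}) :
  (forall v, exists u w, [/\ u \in P false, w \in P true & v = u + w]) ->
  (P false + P true = fullv)%VS.
Proof.
move=> Pf; apply/eqP; rewrite eqEsubv subvf; apply/subvP=> v _.
by have [u [w [Pu Pw ->]]] := Pf v; apply: memv_add.
Qed.

End SuperSpaces.

Section Constructions.

Variable K : fieldType.
Implicit Types U V W : superspace K.

Definition dual_part V (a : bool) : {vspace 'Hom(V, K^o)} :=
  lker (linfun (fun f : 'Hom(V, K^o) => (f \o parity_proj V (~~ a))%VF)).

Lemma mem_dual_part V a (f : 'Hom(V, K^o)) :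
  f \in dual_part V a <-> (forall v, v \in part V (~~ a) -> f v = 0).
Proof.
rewrite memv_ker linfunE; last first.
  by move=> k g h; apply/lfunP=> v; rewrite !lfun_simp.
split=> [/eqP fp0 v va | f0].
  by have /lfunP/(_ v) := fp0; rewrite !lfun_simp parity_proj_id.
by apply/eqP/lfunP=> v; rewrite !lfun_simp f0 ?mem_parity_proj.
Qed.

Lemma dual_part_direct V : directv (dual_part V false + dual_part V true).
Proof.
apply: superspace_direct => f /mem_dual_part f1 /mem_dual_part f0.
apply/lfunP=> v; rewrite -(parity_proj_sum v) linearD /=.
by rewrite f0 ?f1 ?mem_parity_proj // lfunE /= addr0.
Qed.

Lemma dual_part_full V : (dual_part V false + dual_part V true = fullv)%VS.
Proof.
apply: superspace_full => f.
exists (f \o parity_proj V false)%VF, (f \o parity_proj V true)%VF.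
split; last by apply/lfunP=> v; rewrite !lfun_simp -linearD parity_proj_sum.
  by apply/mem_dual_part=> v v1; rewrite lfunE /= (parity_proj_neq v1) ?linear0.
by apply/mem_dual_part=> v v0; rewrite lfunE /= (parity_proj_neq v0) ?linear0.
Qed.

Definition dual V : superspace K :=
  Superspace (dual_part_direct V) (dual_part_full V).

Definition dsum_part U V (a : bool) : {vspace (U * V)%type} :=
  (linfun fst @^-1: part U a :&: linfun snd @^-1: part V a)%VS.

Lemma mem_dsum_part U V a (u : U * V) :
  (u \in dsum_part U V a) = (u.1 \in part U a) && (u.2 \in part V a).
Proof. by rewrite memv_cap -!memv_preim !lfunE. Qed.

Lemma dsum_part_direct U V :
  directv (dsum_part U V false + dsum_part U V true).
Proof.
apply: superspace_direct => -[x y]; rewrite !mem_dsum_part /=.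
move=> /andP[x0 y0] /andP[x1 y1].
by rewrite -(parity_proj_id x0) -(parity_proj_id y0)
  (parity_proj_neq x1) // (parity_proj_neq y1).
Qed.

Lemma dsum_part_full U V :
  (dsum_part U V false + dsum_part U V true = fullv)%VS.
Proof.
apply: superspace_full => -[x y].
exists (parity_proj U false x, parity_proj V false y).
exists (parity_proj U true x, parity_proj V true y).
rewrite !mem_dsum_part /= !mem_parity_proj; split=> //.
by congr (_, _); rewrite parity_proj_sum.
Qed.

Definition dsum U V : superspace K :=
  Superspace (dsum_part_direct U V) (dsum_part_full U V).

End Constructions.

Section Tensors.

Variable K : fieldType.

(* The tensor product, in coordinates: a tensor is its matrix of coefficients *)
(* in the basis of products of coordinate vectors, so that the coefficients   *)
(* of x \ox y are the products of the coordinates of x and y.                 *)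
Definition tens (U V : vectType K) : vectType K := 'M[K]_(dim U, dim V).

Definition pure_tens (U V : vectType K) (x : U) (y : V) : tens U V :=
  (v2r x)^T *m v2r y.

Lemma pure_tens_bilinear (U V : vectType K) : is_bilinear (@pure_tens U V).
Proof.
split=> [y | x] k u v; rewrite /pure_tens linearP.
  by rewrite linearP /= mulmxDl scalemxAl.
by rewrite /= mulmxDr scalemxAr.
Qed.

(* The linear map on the tensor product induced by a bilinear map. *)
Definition tens_lift (U V W : vectType K) (F : U -> V -> W) (t : tens U V) : W :=
  \sum_(i < dim U) \sum_(j < dim V)
    (t : 'M[K]_(_, _)) i j *: F (r2v (delta_mx 0 i)) (r2v (delta_mx 0 j)).

Lemma tens_lift_linear (U V W : vectType K) (F : U -> V -> W) :
  linear (tens_lift F).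
Proof.
move=> k s t; rewrite /tens_lift scaler_sumr -big_split; apply: eq_bigr => i _.
rewrite /= scaler_sumr -big_split; apply: eq_bigr => j _.
by rewrite !mxE scalerDl scalerA.
Qed.

Lemma tens_liftE (U V W : vectType K) (F : U -> V -> W) x y :
  is_bilinear F -> tens_lift F (pure_tens x y) = F x y.
Proof.
move=> [Fl Fr].
have F_suml n (c : 'I_n -> K) (e : 'I_n -> U) z :
    F (\sum_i c i *: e i) z = \sum_i c i *: F (e i) z.
  pose g : {linear U -> W} :=
    HB.pack (F^~ z) (GRing.isLinear.Build K U W *:%R (F^~ z) (Fl z)).
  rewrite -[LHS]/(g _) linear_sum.
  by apply: eq_bigr => i _; rewrite linearZ.
have F_sumr n (c : 'I_n -> K) (e : 'I_n -> V) z :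
    F z (\sum_i c i *: e i) = \sum_i c i *: F z (e i).
  pose g : {linear V -> W} :=
    HB.pack (F z) (GRing.isLinear.Build K V W *:%R (F z) (Fr z)).
  rewrite -[LHS]/(g _) linear_sum.
  by apply: eq_bigr => i _; rewrite linearZ.
have coordsE (X : vectType K) (z : X) :
    z = \sum_i (v2r z) 0 i *: r2v (delta_mx 0 i).
  rewrite -[LHS]v2rK [in LHS](row_sum_delta (v2r z)) linear_sum.
  by apply: eq_bigr => i _; rewrite linearZ.
rewrite [in RHS](coordsE _ x) F_suml; apply: eq_bigr => i _.
rewrite [in RHS](coordsE _ y) F_sumr scaler_sumr; apply: eq_bigr => j _.
by rewrite /pure_tens mxE big_ord1 mxE scalerA.
Qed.

End Tensors.

Notation "x \ox y" := (pure_tens x y) (at level 40, left associativity).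

Section Malcev.

Variable K : fieldType.
Implicit Types A U V L : superspace K.

Record malcev_superalgebra A (br : 'Hom(A, 'End(A))) : Prop := {
  malcev_even : even_bilin br;
  malcev_skew : forall (a b : bool) x y, x \in part A a -> y \in part A b ->
    br x y = - ((-1) ^+ (a * b) *: br y x);
  malcev_identity : forall (a b c d : bool) x y z t,
    x \in part A a -> y \in part A b -> z \in part A c -> t \in part A d ->
    (-1) ^+ (b * c) *: br (br x z) (br y t) =
      br (br (br x y) z) t
      + (-1) ^+ (a * (b + c + d)) *: br (br (br y z) t) x
      + (-1) ^+ ((a + b) * (c + d)) *: br (br (br z t) x) y
      + (-1) ^+ (d * (a + b + c)) *: br (br (br t x) y) z
}.

Record representation A (br : 'Hom(A, 'End(A))) V (rho : 'Hom(A, 'End(V))) :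
    Prop := {
  repr_even : even_bilin rho;
  repr_identity : forall (a b c : bool) x y z,
    x \in part A a -> y \in part A b -> z \in part A c ->
    rho (br (br x y) z) =
      (rho x \o rho y \o rho z)%VF
      - (-1) ^+ (c * (a + b)) *: (rho z \o rho x \o rho y)%VF
      + (-1) ^+ (a * (b + c)) *: (rho y \o rho (br z x))%VF
      - (-1) ^+ (a * (b + c)) *: (rho (br y z) \o rho x)%VF
}.

Definition dual_rep A V (rho : 'Hom(A, 'End(V))) : 'Hom(A, 'End(dual V)) :=
  bilin (homext (fun a b (x : A) (f : dual V) =>
    - ((-1) ^+ (a * b) *: (f \o rho x)%VF) : dual V)).

Lemma dual_repE A V (rho : 'Hom(A, 'End(V))) (a b : bool) x (f : dual V) v :
    x \in part A a -> f \in part (dual V) b ->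
  (dual_rep rho x f : 'Hom(V, K^o)) v =
    - ((-1) ^+ (a * b) * (f : 'Hom(V, K^o)) (rho x v)).
Proof.
move=> xa fb.
have bil (c d : bool) : is_bilinear (fun (x : A) (f : dual V) =>
    - ((-1) ^+ (c * d) *: (f \o rho x)%VF) : dual V).
  split=> [g | y] k u w; apply/lfunP=> z; rewrite !lfun_simp linearP /=.
    by rewrite !lfun_simp linearP /= scalerDr opprD scalerN !scalerA mulrC.
  by rewrite opprD scalerN.
rewrite /dual_rep bilinE; last exact: homext_bilinear.
by rewrite (homextE bil xa fb) !lfun_simp.
Qed.

(* The bracket of the semi-direct product, on A (+) V^*. *)
Definition semidirect_br A (br : 'Hom(A, 'End(A))) V (rho : 'Hom(A, 'End(V))) :
    'Hom(dsum A (dual V), 'End(dsum A (dual V))) :=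
  bilin (homext (fun a b (u v : dsum A (dual V)) =>
    (br u.1 v.1,
     dual_rep rho u.1 v.2 - (-1) ^+ (a * b) *: dual_rep rho v.1 u.2)
      : dsum A (dual V))).

Lemma semidirect_brE A (br : 'Hom(A, 'End(A))) V (rho : 'Hom(A, 'End(V)))
    (a b : bool) (u v : dsum A (dual V)) :
    u \in part (dsum A (dual V)) a -> v \in part (dsum A (dual V)) b ->
  semidirect_br br rho u v =
    (br u.1 v.1,
     dual_rep rho u.1 v.2 - (-1) ^+ (a * b) *: dual_rep rho v.1 u.2).
Proof.
move=> ua vb.
have bil (c d : bool) : is_bilinear (fun u v : dsum A (dual V) =>
    (br u.1 v.1,
     dual_rep rho u.1 v.2 - (-1) ^+ (c * d) *: dual_rep rho v.1 u.2)
      : dsum A (dual V)).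
  split=> [w | w] k s t; congr (_, _).
  - by rewrite linearP /= !lfun_simp.
  - by rewrite /= !linearP /= !lfun_simp addrACA -scalerDr.
  - by rewrite linearP.
  - rewrite /= !linearP /= !lfun_simp scalerDr opprD addrACA scalerBr.
    by rewrite !scalerA (mulrC k).
rewrite /semidirect_br bilinE; last exact: homext_bilinear.
exact: (homextE bil ua vb).
Qed.

Definition super_O_operator A (br : 'Hom(A, 'End(A))) V
    (rho : 'Hom(A, 'End(V))) (T : 'Hom(V, A)) : Prop :=
  even_map T /\
  forall (a b : bool) x y, x \in part V a -> y \in part V b ->
    br (T x) (T y) = T (rho (T x) y - (-1) ^+ (a * b) *: rho (T y) x).

Definition flip U V (t : tens U V) : tens V U :=
  tens_lift (homext (fun a b (x : U) (y : V) => (-1) ^+ (a * b) *: (y \ox x))) t.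

Lemma flipE U V (a b : bool) (x : U) (y : V) :
    x \in part U a -> y \in part V b ->
  flip (x \ox y) = (-1) ^+ (a * b) *: (y \ox x).
Proof.
move=> xa yb.
have bil (c d : bool) :
    is_bilinear (fun (x : U) (y : V) => (-1) ^+ (c * d) *: (y \ox x)).
  have [pl pr] := @pure_tens_bilinear K V U.
  by split=> z k u v; rewrite ?pl ?pr scalerDr !scalerA mulrC.
rewrite /flip tens_liftE; last exact: homext_bilinear.
exact: (homextE bil xa yb).
Qed.

Definition skew_supersymmetric L (r : tens L L) : Prop := r = - flip r.

(* r = sum_i x_i (x) y_i with x_i and y_i homogeneous of parity p_i. *)
Definition even_decomposition L (r : tens L L) n
    (p : 'I_n -> bool) (x y : 'I_n -> L) : Prop :=
  [/\ forall i, x i \in part L (p i), forall i, y i \in part L (p i)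
    & r = \sum_i x i \ox y i].

Definition even_tensor L (r : tens L L) : Prop :=
  exists n (p : 'I_n -> bool) (x y : 'I_n -> L), even_decomposition r p x y.

Section YangBaxter.

Variables (L : superspace K) (br : 'Hom(L, 'End(L))).
Variables (n : nat) (p : 'I_n -> bool) (x y : 'I_n -> L).

Definition br_12_13 : tens (tens L L) L :=
  \sum_i \sum_j (-1) ^+ (p j * p i) *: (br (x i) (x j) \ox y i \ox y j).

Definition br_12_23 : tens (tens L L) L :=
  \sum_i \sum_j x i \ox br (y i) (x j) \ox y j.

Definition br_13_23 : tens (tens L L) L :=
  \sum_i \sum_j (-1) ^+ (p j * p i) *: (x i \ox x j \ox br (y i) (y j)).

End YangBaxter.

(* The left-hand side does not depend on the decomposition of r, so one may   *)
(* equivalently ask for the equation for a single decomposition.              *)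
Definition super_malcev_YBE L (br : 'Hom(L, 'End(L))) (r : tens L L) : Prop :=
  even_tensor r /\
  forall n (p : 'I_n -> bool) (x y : 'I_n -> L), even_decomposition r p x y ->
    br_12_13 br p x y + br_12_23 br x y + br_13_23 br p x y = 0.

Definition dual_basis_vect V n (w : n.-tuple V) (i : 'I_n) : dual V :=
  linfun (coord w i : V -> K^o).

Lemma dual_basis_vectE V n (w : n.-tuple V) (i j : 'I_n) :
  homogeneous_basis w ->
  (dual_basis_vect w i : 'Hom(V, K^o)) w`_j = (i == j)%:R.
Proof.
by move=> [/basis_free wfree _]; rewrite lfunE /= coord_free // eq_sym.
Qed.

(* sum_i T(w_i) (x) w_i^*, as a tensor over A (+) V^*. *)
Definition map_tensor A V n (w : n.-tuple V) (T : 'Hom(V, A)) :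
    tens (dsum A (dual V)) (dsum A (dual V)) :=
  \sum_(i < n) ((T w`_i, 0) : dsum A (dual V))
                 \ox ((0, dual_basis_vect w i) : dsum A (dual V)).

End Malcev.

(* Main.v *)
From HB Require Import structures.
Require Import Defs.
From mathcomp Require Import all_boot all_order all_algebra ssrAC.

Set Implicit Arguments.
Unset Strict Implicit.
Unset Printing Implicit Defensive.

Import GRing.Theory.

Local Open Scope ring_scope.

(** Let [e_i] be the homogeneous basis [w] of [V], of parities [p_i], let [f_i]
    be the dual basis, and measure the failure of the O-operator identity on
    basis vectors by

      [D_ij = [T e_i, T e_j]
            - T (rho (T e_i) e_j - (-1)^(p_i p_j) rho (T e_j) e_i)].

    Everything rests on one identity ([YBE_defect]): the left-hand side of the
    Yang-Baxter equation for [r = T - sigma(T)] is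

      [sum_ij  (-1)^(p_i p_j) D_ij (x) f_i (x) f_j
             - (-1)^(p_i) f_i (x) D_ij (x) f_j
             + (-1)^(p_i + p_j + p_i p_j) f_i (x) f_j (x) D_ij].

    If [T] is an O-operator every [D_ij] is zero, and so is this sum.
    Conversely the three families lie in the independent summands A.V*.V*,
    V*.A.V* and V*.V*.A of the triple tensor product, so evaluating the last
    two factors on [e_k] and [e_l] ([eval_last_two]) isolates [D_kl] up to a
    sign; and the vanishing of all [D_kl] is the O-operator identity by
    bilinearity ([super_O_operator_basisE]).

    To obtain the identity, one expands the three brackets on the explicit
    decomposition of [r] by the vectors [T e_i] and [f_i].  Brackets
    [[T e_i, T e_j]] give the first term of [D_ij]; brackets of some [T e_i]
    with some [f_j] bring in the dual representation, which
    [dual_rep_contract] transfers from [f_j] to the argument of [T], giving the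
    other two terms; brackets of two [f]'s vanish.

    The Yang-Baxter equation is required for every homogeneous decomposition of
    [r].  This reduces to the explicit one because each bracket, as a function
    of a decomposition, is induced by a quadrilinear map twisted by signs
    depending on parities only, and hence factors through the tensor [r]
    ([signed_sumE], [YBE_decomposition_indep]). *)

(** * Linear and bilinear maps *)

Section BilinearRules.

Variable K : fieldType.

(** [linear] is a predicate on bare functions, which the rules for bundled linear
    maps do not see; this and the next lemma do the bundling. *)
Lemma linear_bigE (U V : lmodType K) (f : U -> V) (I : Type) (s : seq I)
    (P : pred I) (u : I -> U) :
  linear f -> f (\sum_(i <- s | P i) u i) = \sum_(i <- s | P i) f (u i).
Proof.
move=> flin; pose f' : {linear U -> V} :=
  HB.pack f (GRing.isLinear.Build K U V *:%R f flin).
exact: (linear_sum f').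
Qed.

Lemma linear_scaleE (U V : lmodType K) (f : U -> V) k u :
  linear f -> f (k *: u) = k *: f u.
Proof.
move=> flin; pose f' : {linear U -> V} :=
  HB.pack f (GRing.isLinear.Build K U V *:%R f flin).
by rewrite -[LHS]/(f' _) linearZ.
Qed.

Variables (U V W : lmodType K) (F : U -> V -> W).
Hypothesis F_bil : is_bilinear F.

Lemma bilinear_suml (I : Type) (s : seq I) (P : pred I) (u : I -> U) y :
  F (\sum_(i <- s | P i) u i) y = \sum_(i <- s | P i) F (u i) y.
Proof. exact: (linear_bigE _ _ _ (F_bil.1 y)). Qed.

Lemma bilinear_sumr (I : Type) (s : seq I) (P : pred I) x (v : I -> V) :
  F x (\sum_(i <- s | P i) v i) = \sum_(i <- s | P i) F x (v i).
Proof. exact: (linear_bigE _ _ _ (F_bil.2 x)). Qed.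

Lemma bilinearZl k x y : F (k *: x) y = k *: F x y.
Proof. exact: (linear_scaleE _ _ (F_bil.1 y)). Qed.

Lemma bilinearZr k x y : F x (k *: y) = k *: F x y.
Proof. exact: (linear_scaleE _ _ (F_bil.2 x)). Qed.

Lemma bilinear0l y : F 0 y = 0.
Proof. by rewrite -[X in F X](scale0r 0) bilinearZl scale0r. Qed.

Lemma bilinear0r x : F x 0 = 0.
Proof. by rewrite -[X in F x X](scale0r 0) bilinearZr scale0r. Qed.

End BilinearRules.

Lemma bilinear_basis_eq0 (K : fieldType) (V W : vectType K) (F : V -> V -> W)
    n (w : n.-tuple V) :
    is_bilinear F -> basis_of fullv w ->
    (forall i j : 'I_n, F w`_i w`_j = 0) ->
  forall x y, F x y = 0.
Proof.
move=> Fbil wb F0 x y.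
rewrite (coord_basis wb (memvf x)) (coord_basis wb (memvf y)).
rewrite (bilinear_suml Fbil) big1 // => i _.
rewrite (bilinear_sumr Fbil) big1 // => j _.
by rewrite (bilinearZl Fbil) (bilinearZr Fbil) F0 !scaler0.
Qed.

(** * Tensors *)

Section TensorRules.

Variable K : fieldType.
Implicit Types U V W : vectType K.

Lemma tensPl U V k (x x' : U) (y : V) :
  (k *: x + x') \ox y = k *: (x \ox y) + x' \ox y.
Proof. exact: ((pure_tens_bilinear U V).1 y). Qed.

Lemma tensPr U V k (x : U) (y y' : V) :
  x \ox (k *: y + y') = k *: (x \ox y) + x \ox y'.
Proof. exact: ((pure_tens_bilinear U V).2 x). Qed.

Lemma tensZl U V k (x : U) (y : V) : (k *: x) \ox y = k *: (x \ox y).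
Proof. exact: (bilinearZl (pure_tens_bilinear U V)). Qed.

Lemma tensZr U V k (x : U) (y : V) : x \ox (k *: y) = k *: (x \ox y).
Proof. exact: (bilinearZr (pure_tens_bilinear U V)). Qed.

Lemma tens0l U V (y : V) : (0 : U) \ox y = 0.
Proof. exact: (bilinear0l (pure_tens_bilinear U V)). Qed.

Lemma tens0r U V (x : U) : x \ox (0 : V) = 0.
Proof. exact: (bilinear0r (pure_tens_bilinear U V)). Qed.

Lemma tens_lift_sum U V W (F : U -> V -> W) n (x : 'I_n -> U) (y : 'I_n -> V) :
  is_bilinear F -> tens_lift F (\sum_i x i \ox y i) = \sum_i F (x i) (y i).
Proof.
move=> Fbil; rewrite (linear_bigE _ _ _ (tens_lift_linear F)).
by apply: eq_bigr => i _; rewrite tens_liftE.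
Qed.

(** What makes it possible to apply [tens_lift] twice: the inner lift is still
    bilinear in the parameters [u] and [v]. *)
Lemma tens_lift_bilinear (U1 V1 : lmodType K) U V W
    (G : U1 -> V1 -> U -> V -> W) t :
    (forall x y, is_bilinear (fun u v => G u v x y)) ->
  is_bilinear (fun u v => tens_lift (G u v) t).
Proof.
move=> Gbil; split=> z k u v; rewrite /tens_lift scaler_sumr -big_split /=;
  apply: eq_bigr => i _; rewrite scaler_sumr -big_split /=;
  apply: eq_bigr => j _; rewrite scalerA mulrC -scalerA -scalerDr.
  by congr (_ *: _); apply: ((Gbil _ _).1 z).
by congr (_ *: _); apply: ((Gbil _ _).2 z).
Qed.

End TensorRules.

(** * Independence of the decomposition *)

Section Decompositions.

Variables (K : fieldType) (L : superspace K).

Record quadrilinear (W : vectType K) (g : L -> L -> L -> L -> W) : Prop := {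
  quad1 : forall y x' y', linear (fun x => g x y x' y');
  quad2 : forall x x' y', linear (fun y => g x y x' y');
  quad3 : forall x y y', linear (fun x' => g x y x' y');
  quad4 : forall x y x', linear (g x y x')
}.

(** The sign in front of [g x y x' y'] depends on the parities of [y] and [x'],
    so it only makes sense on homogeneous vectors; splitting these two arguments
    into their homogeneous parts gives a map that is quadrilinear everywhere. *)
Definition signed_ext (W : vectType K) (s : bool -> bool -> K)
    (g : L -> L -> L -> L -> W) (x y x' y' : L) : W :=
  homext (fun a b u v => s a b *: g x u v y') y x'.

Section SignedExt.

Variables (W : vectType K) (s : bool -> bool -> K) (g : L -> L -> L -> L -> W).
Hypothesis g_quad : quadrilinear g.

Let signed_bilinear x y' a b : is_bilinear (fun u v => s a b *: g x u v y').
Proof.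
split=> z k u v; rewrite scalerA mulrC -scalerA -scalerDr; congr (_ *: _).
  exact: (quad2 g_quad).
exact: (quad3 g_quad).
Qed.

Lemma signed_ext_linear1 y x' y' : linear (fun x => signed_ext s g x y x' y').
Proof.
move=> k u v; rewrite /signed_ext /homext scaler_sumr -big_split /=.
apply: eq_bigr => a _; rewrite scaler_sumr -big_split /=; apply: eq_bigr => b _.
rewrite scalerA mulrC -scalerA -scalerDr; congr (_ *: _).
exact: (quad1 g_quad).
Qed.

Lemma signed_ext_linear4 x y x' : linear (fun y' => signed_ext s g x y x' y').
Proof.
move=> k u v; rewrite /signed_ext /homext scaler_sumr -big_split /=.
apply: eq_bigr => a _; rewrite scaler_sumr -big_split /=; apply: eq_bigr => b _.
rewrite scalerA mulrC -scalerA -scalerDr; congr (_ *: _).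
exact: (quad4 g_quad).
Qed.

Lemma signed_ext_bilinear12 x' y' :
  is_bilinear (fun x y => signed_ext s g x y x' y').
Proof.
split=> [y | x]; first exact: signed_ext_linear1.
exact: ((homext_bilinear (signed_bilinear x y')).1 x').
Qed.

Lemma signed_ext_bilinear34 x y : is_bilinear (signed_ext s g x y).
Proof.
split=> [y' | x']; last exact: signed_ext_linear4.
exact: ((homext_bilinear (signed_bilinear x y')).2 y).
Qed.

(** A sum over a decomposition of [r] depends only on [r]: its terms are the values
    of a quadrilinear map, which is defined on the pairs (x_i, y_i) and
    (x_j, y_j) through their tensor products. *)
Lemma signed_sumE (r : tens L L) n (p : 'I_n -> bool) (x y : 'I_n -> L) :
    even_decomposition r p x y ->
  \sum_i \sum_j s (p i) (p j) *: g (x i) (y i) (x j) (y j) =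
    tens_lift (fun u v => tens_lift (signed_ext s g u v) r) r.
Proof.
move=> [xp yp ->]; rewrite tens_lift_sum; last first.
  exact/tens_lift_bilinear/signed_ext_bilinear12.
apply: eq_bigr => i _; rewrite tens_lift_sum; last exact: signed_ext_bilinear34.
apply: eq_bigr => j _; rewrite /signed_ext.
by rewrite (homextE (signed_bilinear _ _) (yp i) (xp j)).
Qed.

End SignedExt.

Variable br : 'Hom(L, 'End(L)).

Lemma quadrilinear_12_13 : quadrilinear (fun x y x' y' => br x x' \ox y \ox y').
Proof.
by split=> *; move=> k u v;
  rewrite ?linearP ?lfun_simp ?(tensPl, tensPr) ?linearP ?tensPl.
Qed.

Lemma quadrilinear_12_23 : quadrilinear (fun x y x' y' => x \ox br y x' \ox y').
Proof.
by split=> *; move=> k u v;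
  rewrite ?linearP ?lfun_simp ?(tensPl, tensPr) ?linearP ?tensPl.
Qed.

Lemma quadrilinear_13_23 : quadrilinear (fun x y x' y' => x \ox x' \ox br y y').
Proof.
by split=> *; move=> k u v;
  rewrite ?linearP ?lfun_simp ?(tensPl, tensPr) ?linearP ?tensPl.
Qed.

(** The middle bracket carries no sign, hence the sign function constantly 1. *)
Lemma YBE_decomposition_indep (r : tens L L)
    n (p : 'I_n -> bool) (x y : 'I_n -> L)
    m (q : 'I_m -> bool) (x' y' : 'I_m -> L) :
    even_decomposition r p x y -> even_decomposition r q x' y' ->
  br_12_13 br p x y + br_12_23 br x y + br_13_23 br p x y =
  br_12_13 br q x' y' + br_12_23 br x' y' + br_13_23 br q x' y'.
Proof.
pose sg (a b : bool) : K := (-1) ^+ (b * a).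
have E k (c : 'I_k -> bool) (u v : 'I_k -> L) : even_decomposition r c u v ->
    br_12_13 br c u v + br_12_23 br u v + br_13_23 br c u v =
    tens_lift (fun a b => tens_lift
      (signed_ext sg (fun x y x' y' => br x x' \ox y \ox y') a b) r) r
    + tens_lift (fun a b => tens_lift
      (signed_ext (fun _ _ => 1) (fun x y x' y' => x \ox br y x' \ox y') a b) r) r
    + tens_lift (fun a b => tens_lift
      (signed_ext sg (fun x y x' y' => x \ox x' \ox br y y') a b) r) r.
  move=> dec; rewrite -(signed_sumE sg quadrilinear_12_13 dec).
  rewrite -(signed_sumE sg quadrilinear_13_23 dec).
  rewrite -(signed_sumE _ quadrilinear_12_23 dec).
  congr (_ + _ + _); apply: eq_bigr => i _; apply: eq_bigr => j _.
  by rewrite scale1r.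
by move=> dx dy; rewrite (E _ _ _ _ dx) (E _ _ _ _ dy).
Qed.

End Decompositions.

(** * Homogeneous bases and the dual representation *)

Section HomogeneousBasis.

Variables (K : fieldType) (V : superspace K) (n : nat) (w : n.-tuple V).
Hypothesis w_basis : homogeneous_basis w.

Definition basis_parity (i : 'I_n) : bool := w`_i \in part V true.

Let f (i : 'I_n) : dual V := dual_basis_vect w i.

Lemma basis_vect_mem (i : 'I_n) : w`_i \in part V (basis_parity i).
Proof.
have [_ /(_ i)[a]] := w_basis; rewrite /basis_parity.
by case: a; case: (boolP (w`_i \in part V true)).
Qed.

Lemma coord_expand v : v = \sum_i coord w i v *: w`_i.
Proof. exact/coord_basis/memvf/w_basis.1. Qed.

(** The projection on parity [a] fixes [v] and kills the basis vectors of the other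
    parity, so only those of parity [a] occur in [v]. *)
Lemma coord_parity a i v :
  v \in part V a -> a != basis_parity i -> coord w i v = 0.
Proof.
move=> va ai; rewrite -(parity_proj_id va) (coord_expand v) linear_sum.
have -> : \sum_j parity_proj V a (coord w j v *: w`_j) =
    \sum_j ((a == basis_parity j)%:R * coord w j v) *: w`_j.
  apply: eq_bigr => j _; rewrite linearZ /=; case: eqP => [-> | /eqP aj].
    by rewrite parity_proj_id ?basis_vect_mem // mul1r.
  by rewrite (parity_proj_neq (basis_vect_mem j)) // mul0r scale0r scaler0.
rewrite coord_sum_free; last exact: basis_free w_basis.1.
by rewrite (negPf ai) mul0r.
Qed.

Lemma dual_basis_mem i : f i \in part (dual V) (basis_parity i).
Proof.
apply/mem_dual_part => v /(@coord_parity _ i) v0.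
by rewrite linfunE ?v0 //; [case: basis_parity | apply: linearP].
Qed.

Lemma dual_expand (g : 'Hom(V, K^o)) : g = \sum_(i < n) g w`_i *: f i.
Proof.
apply/lfunP=> v; rewrite sum_lfunE [in LHS](coord_expand v) linear_sum.
apply: eq_bigr => i _; rewrite linearZ lfunE /= linfunE; last exact: linearP.
exact: mulrC.
Qed.

Variables (A : superspace K) (rho : 'Hom(A, 'End(V))).
Hypothesis rho_even : even_bilin rho.

Lemma dual_rep_basis (a : bool) x j : x \in part A a ->
  dual_rep rho x (f j) =
    \sum_(k < n) - ((-1) ^+ (a * basis_parity j) * coord w j (rho x w`_k)) *: f k.
Proof.
move=> xa; rewrite [LHS]dual_expand; apply: eq_bigr => k _.
rewrite (dual_repE _ _ xa (dual_basis_mem j)) linfunE //; exact: linearP.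
Qed.

(** Transposition: moving the action of [x] from [f_j] to the other factor.  In the
    coordinates c_jk of [rho x], the action of [x] sends e_k to the sum over j
    of c_jk e_j, and f_j to minus the sum over k of c_jk f_k, up to sign.  A sign
    [s] depending on the parity of the summation index [j] can be carried along,
    since c_jk vanishes unless p_j = a + p_k. *)
Lemma dual_rep_contract (W : vectType K) (Phi : dual V -> A -> W)
    (T : 'Hom(V, A)) (s : bool -> K) (a : bool) x :
    is_bilinear Phi -> x \in part A a ->
  \sum_j s (basis_parity j) *: Phi (dual_rep rho x (f j)) (T w`_j) =
  \sum_k - (s (a (+) basis_parity k) * (-1) ^+ (a * (a (+) basis_parity k)))
     *: Phi (f k) (T (rho x w`_k)).
Proof.
move=> Phib xa.
under eq_bigr => j _.
  rewrite (dual_rep_basis j xa) (bilinear_suml Phib) scaler_sumr.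
  over.
rewrite exchange_big; apply: eq_bigr => k _ /=.
rewrite [in RHS](coord_expand (rho x w`_k)) linear_sum (bilinear_sumr Phib).
rewrite scaler_sumr; apply: eq_bigr => j _.
rewrite linearZ (bilinearZl Phib) (bilinearZr Phib) !scalerA.
have [<- | jk] := eqVneq (a (+) basis_parity k) (basis_parity j).
  by rewrite mulrN mulNr mulrA.
have rk : rho x w`_k \in part V (a (+) basis_parity k).
  exact: rho_even xa (basis_vect_mem k).
by rewrite (coord_parity rk jk) !mulr0 oppr0 mulr0.
Qed.

End HomogeneousBasis.

(** * Brackets in the semi-direct product *)

Section SemidirectProduct.

Variables (K : fieldType) (A V : superspace K).
Variables (br : 'Hom(A, 'End(A))) (rho : 'Hom(A, 'End(V))).

Local Notation L := (dsum A (dual V)).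

Definition inA (x : A) : L := (x, 0).
Definition inD (g : dual V) : L := (0, g).

Lemma inA_mem a x : x \in part A a -> inA x \in part L a.
Proof. by move=> xa; rewrite mem_dsum_part xa mem0v. Qed.

Lemma inD_mem a g : g \in part (dual V) a -> inD g \in part L a.
Proof. by move=> ga; rewrite mem_dsum_part ga mem0v. Qed.

Lemma inA_linear : linear inA.
Proof. by move=> k u v; congr (_, _); rewrite /= scaler0 addr0. Qed.

Lemma inD_linear : linear inD.
Proof. by move=> k u v; congr (_, _); rewrite /= scaler0 addr0. Qed.

Local Notation brL := (semidirect_br br rho).

Lemma semidirect_AA a b x y : x \in part A a -> y \in part A b ->
  brL (inA x) (inA y) = inA (br x y).
Proof.
move=> xa yb; rewrite (semidirect_brE _ _ (inA_mem xa) (inA_mem yb)) /=.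
by rewrite !linear0 addr0.
Qed.

Lemma semidirect_AD a b x g : x \in part A a -> g \in part (dual V) b ->
  brL (inA x) (inD g) = inD (dual_rep rho x g).
Proof.
move=> xa gb; rewrite (semidirect_brE _ _ (inA_mem xa) (inD_mem gb)) /=.
by rewrite !linear0 addr0.
Qed.

Lemma semidirect_DA (a b : bool) x g : x \in part A a -> g \in part (dual V) b ->
  brL (inD g) (inA x) = - (-1) ^+ (b * a) *: inD (dual_rep rho x g).
Proof.
move=> xa gb; rewrite (semidirect_brE _ _ (inD_mem gb) (inA_mem xa)) /=.
have -> : br 0 x = 0 by rewrite linear0 lfunE.
have -> : dual_rep rho (0 : A) (0 : dual V) = 0 by rewrite linear0.
by rewrite sub0r -scaleNr; congr (_, _); rewrite /= scaler0.
Qed.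

Lemma semidirect_DD a b g h : g \in part (dual V) a -> h \in part (dual V) b ->
  brL (inD g) (inD h) = 0.
Proof.
move=> ga hb; rewrite (semidirect_brE _ _ (inD_mem ga) (inD_mem hb)) /=.
have -> : br 0 0 = 0 by rewrite linear0.
have rep0 k : dual_rep rho 0 k = 0 by rewrite linear0 lfunE.
by rewrite !rep0 scaler0 subr0.
Qed.

End SemidirectProduct.

(** * The Yang-Baxter equation for the skew tensor of a linear map *)

Lemma sum_split (W : nmodType) m n (F : 'I_m + 'I_n -> W) :
  \sum_(k < m + n) F (split k) = \sum_i F (inl i) + \sum_j F (inr j).
Proof.
rewrite big_split_ord /=; congr (_ + _); apply: eq_bigr => i _.
  by rewrite (unsplitK (inl i)).
by rewrite (unsplitK (inr i)).
Qed.

Lemma sum_split2 (W : nmodType) n (F : 'I_n + 'I_n -> 'I_n + 'I_n -> W) :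
  \sum_(k < n + n) \sum_(l < n + n) F (split k) (split l) =
    \sum_i \sum_j F (inl i) (inl j) + \sum_i \sum_j F (inl i) (inr j)
    + \sum_i \sum_j F (inr i) (inl j) + \sum_i \sum_j F (inr i) (inr j).
Proof.
under eq_bigr do rewrite sum_split.
rewrite (sum_split (fun u => \sum_j F u (inl j) + \sum_j F u (inr j))).
by rewrite !big_split !addrA.
Qed.

Lemma addr3_eq (W : nmodType) (a b c a' b' c' : W) :
  a = a' -> b = b' -> c = c' -> a + b + c = a' + b' + c'.
Proof. by move=> -> -> ->. Qed.

Ltac simp_signs :=
  rewrite /= ?(mul0n, mul1n, add0n, addn0, exprD, expr0, expr1, sqrrN, expr1n, mulNr,
               mulrN, mul1r, mulr1, opprK).

Lemma flip_linear (K : fieldType) (U V : superspace K) : linear (@flip K U V).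
Proof. exact: tens_lift_linear. Qed.

Section YangBaxterExpansion.

Variables (K : fieldType) (A V : superspace K).
Variables (br : 'Hom(A, 'End(A))) (rho : 'Hom(A, 'End(V))).
Variables (T : 'Hom(V, A)) (n : nat) (w : n.-tuple V).
Hypotheses (rho_even : even_bilin rho) (T_even : even_map T).
Hypothesis w_basis : homogeneous_basis w.

Local Notation L := (dsum A (dual V)).
Local Notation brL := (semidirect_br br rho).
Local Notation p := (basis_parity w).
Local Notation inA := (@inA K A V).
Local Notation inD := (@inD K A V).

Let f (i : 'I_n) : dual V := dual_basis_vect w i.
Let e (i : 'I_n) : V := w`_i.
Let rT (i j : 'I_n) : A := T (rho (T (e i)) (e j)).

Definition defect (a b : bool) (x y : V) : A :=
  br (T x) (T y) - T (rho (T x) y - (-1) ^+ (a * b) *: rho (T y) x).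

(** The decomposition of [T - sigma(T)] has [n + n] terms, indexed through [split]:
    the left copy lists those of [T], the right copy those of [- sigma(T)]. *)
Definition skew_parity (u : 'I_n + 'I_n) : bool :=
  match u with inl i => p i | inr i => p i end.

Definition skew_left (u : 'I_n + 'I_n) : L :=
  match u with
  | inl i => inA (T w`_i)
  | inr i => - (-1) ^+ p i *: inD (dual_basis_vect w i)
  end.

Definition skew_right (u : 'I_n + 'I_n) : L :=
  match u with
  | inl i => inD (dual_basis_vect w i)
  | inr i => inA (T w`_i)
  end.

Let Te_mem i : T (e i) \in part A (p i).
Proof. exact/T_even/basis_vect_mem. Qed.

Let f_mem i : f i \in part (dual V) (p i).
Proof. exact: dual_basis_mem. Qed.

Lemma flip_map_tensor :
  flip (map_tensor w T) = \sum_i (-1) ^+ p i *: (inD (f i) \ox inA (T (e i))).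
Proof.
rewrite (linear_bigE _ _ _ (@flip_linear K _ _)); apply: eq_bigr => i _.
by rewrite (flipE (inA_mem V (Te_mem i)) (inD_mem A (f_mem i))); case: (p i).
Qed.

Lemma skew_decomposition :
  even_decomposition (map_tensor w T - flip (map_tensor w T))
    (fun k => skew_parity (split k)) (fun k => skew_left (split k))
    (fun k => skew_right (split k)).
Proof.
split=> [k | k |].
- case: (split k) => i /=; first exact: inA_mem (Te_mem i).
  by rewrite memvZ ?inD_mem ?f_mem.
- case: (split k) => i /=; first by rewrite inD_mem ?f_mem.
  exact: inA_mem (Te_mem i).
rewrite (sum_split (fun u => skew_left u \ox skew_right u)) flip_map_tensor -sumrN.
by congr (_ + _); apply: eq_bigr => i _; rewrite tensZl scaleNr.
Qed.

(** The flip is an involution, as the sign occurs twice. *)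
Lemma skew_map_tensor :
  skew_supersymmetric (map_tensor w T - flip (map_tensor w T)).
Proof.
have flipB s t : flip (s - t) = flip s - flip t :> tens L L.
  by rewrite [s - t]addrC -scaleN1r (@flip_linear K L L) scaleN1r addrC.
rewrite /skew_supersymmetric flipB opprB; congr (_ - _).
rewrite flip_map_tensor (linear_bigE _ _ _ (@flip_linear K _ _)).
apply: eq_bigr => i _; rewrite (linear_scaleE _ _ (@flip_linear K _ _)).
rewrite (flipE (inD_mem A (f_mem i)) (inA_mem V (Te_mem i))) scalerA.
by case: (p i); rewrite ?mulrNN mulr1 scale1r.
Qed.

Let bil := (tensPl, tensPr, inA_linear, inD_linear).

Let contract (W : vectType K) (Phi : dual V -> A -> W) (s : bool -> K) i :
    is_bilinear Phi ->
  \sum_j s (p j) *: Phi (dual_rep rho (T (e i)) (f j)) (T (e j)) =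
  \sum_k - (s (p i (+) p k) * (-1) ^+ (p i * (p i (+) p k)))
     *: Phi (f k) (rT i k).
Proof. by move=> Phib; apply: dual_rep_contract. Qed.

(** In each of the three expansions the four blocks of the double sum come from the
    two copies of the index set.  One block vanishes, being made of brackets of
    two dual vectors; one is a bracket in [A]; the other two are contracted.  The
    indices are then renamed so that [i] and [j] always label the dual vectors
    in order from left to right, which makes the terms comparable. *)
Lemma expand_12_13 :
  br_12_13 brL (fun k => skew_parity (split k)) (fun k => skew_left (split k))
    (fun k => skew_right (split k)) =
  \sum_i \sum_j (-1) ^+ (p i * p j) *:
     (inA (br (T (e i)) (T (e j))) \ox inD (f i) \ox inD (f j))
  + \sum_i \sum_j (-1) ^+ (p i + p j) *:
     (inD (f i) \ox inD (f j) \ox inA (rT j i))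
  + \sum_i \sum_j - (-1) ^+ (p i + p i * p j) *:
     (inD (f i) \ox inA (rT j i) \ox inD (f j)).
Proof.
rewrite /br_12_13 (sum_split2 (fun u v => (-1) ^+ (skew_parity v * skew_parity u)
  *: (brL (skew_left u) (skew_left v) \ox skew_right u \ox skew_right v))).
rewrite [X in _ + X]big1 ?addr0 => [|i _]; last first.
  apply: big1 => j _; rewrite /= linearZ /= linearZ !lfun_simp.
  by rewrite (semidirect_DD br rho (f_mem i) (f_mem j)) !scaler0 !tens0l scaler0.
apply: addr3_eq.
- apply: eq_bigr => i _; apply: eq_bigr => j _ /=.
  by rewrite (semidirect_AA _ _ (Te_mem i) (Te_mem j)) mulnC.
- rewrite [in RHS]exchange_big; apply: eq_bigr => i _ /=.
  pose s b : K := (-1) ^+ (b * p i) * - (-1) ^+ b.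
  pose Phi (g : dual V) (x : A) := inD g \ox inD (f i) \ox inA x.
  have PhiB : is_bilinear Phi by split=> z k u v; rewrite /Phi !bil.
  transitivity (\sum_j s (p j) *: Phi (dual_rep rho (T (e i)) (f j)) (T (e j))).
    apply: eq_bigr => j _; rewrite linearZ /= (semidirect_AD _ _ (Te_mem i) (f_mem j)).
    by rewrite !tensZl scalerA.
  rewrite (contract s i PhiB).
  apply: eq_bigr => k _; congr (_ *: _); rewrite /s.
  by case: (p i); case: (p k); simp_signs.
rewrite exchange_big [in RHS]exchange_big; apply: eq_bigr => i _ /=.
pose s b : K := (-1) ^+ b.
pose Phi (g : dual V) (x : A) := inD g \ox inA x \ox inD (f i).
have PhiB : is_bilinear Phi by split=> z k u v; rewrite /Phi !bil.
transitivity (\sum_j s (p j) *: Phi (dual_rep rho (T (e i)) (f j)) (T (e j))).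
  apply: eq_bigr => j _; rewrite linearZ !lfun_simp.
  rewrite (semidirect_DA _ _ (Te_mem i) (f_mem j)).
  rewrite !tensZl !scalerA; congr (_ *: _); rewrite /s.
  by case: (p i); case: (p j); simp_signs.
rewrite (contract s i PhiB).
apply: eq_bigr => k _; congr (_ *: _); rewrite /s.
by case: (p i); case: (p k); simp_signs.
Qed.

Lemma expand_12_23 :
  br_12_23 brL (fun k => skew_left (split k)) (fun k => skew_right (split k)) =
  \sum_i \sum_j (inA (rT j i) \ox inD (f i) \ox inD (f j))
  + \sum_i \sum_j - (-1) ^+ p i *:
     (inD (f i) \ox inA (br (T (e i)) (T (e j))) \ox inD (f j))
  + \sum_i \sum_j - (-1) ^+ (p i + p j + p i * p j) *:
     (inD (f i) \ox inD (f j) \ox inA (rT i j)).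
Proof.
rewrite /br_12_23
  (sum_split2 (fun u v =>
     skew_left u \ox brL (skew_right u) (skew_left v) \ox skew_right v)).
rewrite [X in _ + X + _ + _]big1 ?addr0 => [|i _]; last first.
  apply: big1 => j _; rewrite /= linearZ /=.
  by rewrite (semidirect_DD br rho (f_mem i) (f_mem j)) scaler0 tens0r tens0l.
apply: addr3_eq.
- rewrite exchange_big [in RHS]exchange_big; apply: eq_bigr => i _ /=.
  pose s b : K := - (-1) ^+ (b * p i).
  pose Phi (g : dual V) (x : A) := inA x \ox inD g \ox inD (f i).
  have PhiB : is_bilinear Phi by split=> z k u v; rewrite /Phi !bil.
  transitivity (\sum_j s (p j) *: Phi (dual_rep rho (T (e i)) (f j)) (T (e j))).
    apply: eq_bigr => j _; rewrite (semidirect_DA _ _ (Te_mem i) (f_mem j)).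
    by rewrite tensZr tensZl.
  rewrite (contract s i PhiB).
  apply: eq_bigr => k _; rewrite -[RHS]scale1r; congr (_ *: _); rewrite /s.
  by case: (p i); case: (p k); simp_signs.
- apply: eq_bigr => i _; apply: eq_bigr => j _ /=.
  by rewrite (semidirect_AA _ _ (Te_mem i) (Te_mem j)) !tensZl.
apply: eq_bigr => i _ /=.
pose s b : K := - (-1) ^+ p i * - (-1) ^+ b.
pose Phi (g : dual V) (x : A) := inD (f i) \ox inD g \ox inA x.
have PhiB : is_bilinear Phi by split=> z k u v; rewrite /Phi !bil.
transitivity (\sum_j s (p j) *: Phi (dual_rep rho (T (e i)) (f j)) (T (e j))).
  apply: eq_bigr => j _.
  rewrite linearZ /= (semidirect_AD _ _ (Te_mem i) (f_mem j)).
  by rewrite tensZr !tensZl !scalerA mulrC.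
rewrite (contract s i PhiB).
apply: eq_bigr => k _; congr (_ *: _); rewrite /s.
by case: (p i); case: (p k); simp_signs.
Qed.

Lemma expand_13_23 :
  br_13_23 brL (fun k => skew_parity (split k)) (fun k => skew_left (split k))
    (fun k => skew_right (split k)) =
  \sum_i \sum_j - (-1) ^+ (p i * p j) *:
     (inA (rT i j) \ox inD (f i) \ox inD (f j))
  + \sum_i \sum_j (-1) ^+ p i *:
     (inD (f i) \ox inA (rT i j) \ox inD (f j))
  + \sum_i \sum_j (-1) ^+ (p i + p j + p i * p j) *:
     (inD (f i) \ox inD (f j) \ox inA (br (T (e i)) (T (e j)))).
Proof.
rewrite /br_13_23 (sum_split2 (fun u v => (-1) ^+ (skew_parity v * skew_parity u)
  *: (skew_left u \ox skew_left v \ox brL (skew_right u) (skew_right v)))).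
rewrite [X in X + _ + _ + _]big1 ?add0r => [|i _]; last first.
  apply: big1 => j _ /=.
  by rewrite (semidirect_DD br rho (f_mem i) (f_mem j)) tens0r scaler0.
apply: addr3_eq.
- rewrite exchange_big; apply: eq_bigr => i _ /=.
  pose s (b : bool) : K := (-1) ^+ p i.
  pose Phi (g : dual V) (x : A) := inA x \ox inD (f i) \ox inD g.
  have PhiB : is_bilinear Phi by split=> z k u v; rewrite /Phi !bil.
  transitivity (\sum_j s (p j) *: Phi (dual_rep rho (T (e i)) (f j)) (T (e j))).
    apply: eq_bigr => j _; rewrite (semidirect_DA _ _ (Te_mem i) (f_mem j)).
    rewrite !tensZr !tensZl !scalerA; congr (_ *: _); rewrite /s.
    by case: (p i); case: (p j); simp_signs.
  rewrite (contract s i PhiB).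
  apply: eq_bigr => k _; congr (_ *: _); rewrite /s.
  by case: (p i); case: (p k); simp_signs.
- apply: eq_bigr => i _ /=.
  pose s b : K := (-1) ^+ (b * p i) * - (-1) ^+ p i.
  pose Phi (g : dual V) (x : A) := inD (f i) \ox inA x \ox inD g.
  have PhiB : is_bilinear Phi by split=> z k u v; rewrite /Phi !bil.
  transitivity (\sum_j s (p j) *: Phi (dual_rep rho (T (e i)) (f j)) (T (e j))).
    apply: eq_bigr => j _; rewrite (semidirect_AD _ _ (Te_mem i) (f_mem j)).
    by rewrite !tensZl !scalerA.
  rewrite (contract s i PhiB).
  apply: eq_bigr => k _; congr (_ *: _); rewrite /s.
  by case: (p i); case: (p k); simp_signs.
apply: eq_bigr => i _; apply: eq_bigr => j _ /=.
rewrite (semidirect_AA _ _ (Te_mem i) (Te_mem j)) !(tensZl, tensZr) !scalerA.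
by congr (_ *: _); case: (p i); case: (p j); simp_signs.
Qed.

Let D (i j : 'I_n) : A := defect (p i) (p j) (e i) (e j).

(** In each position of the factor from [A], the three terms of [D i j] come from
    the three different brackets. *)
Lemma YBE_defect :
  br_12_13 brL (fun k => skew_parity (split k)) (fun k => skew_left (split k))
    (fun k => skew_right (split k))
  + br_12_23 brL (fun k => skew_left (split k)) (fun k => skew_right (split k))
  + br_13_23 brL (fun k => skew_parity (split k)) (fun k => skew_left (split k))
    (fun k => skew_right (split k)) =
  \sum_i \sum_j (-1) ^+ (p i * p j) *: (inA (D i j) \ox inD (f i) \ox inD (f j))
  + \sum_i \sum_j - (-1) ^+ p i *: (inD (f i) \ox inA (D i j) \ox inD (f j))
  + \sum_i \sum_j (-1) ^+ (p i + p j + p i * p j) *: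
      (inD (f i) \ox inD (f j) \ox inA (D i j)).
Proof.
have DE i j : D i j =
    (-1) ^+ (p i * p j) *: rT j i + (-1 *: rT i j + br (T (e i)) (T (e j))).
  rewrite /D /defect linearB linearZ opprB scaleN1r addrC /=.
  exact/esym/addrA.
rewrite expand_12_13 expand_12_23 expand_13_23.
(* The nine double sums are regrouped by the position of the factor in [A]. *)
rewrite (AC (3*3*3) ((4*7*1)*(3*8*5)*(2*6*9))) /=.
apply: addr3_eq; rewrite -!big_split; apply: eq_bigr => i _;
  rewrite -!big_split; apply: eq_bigr => j _ /=;
  rewrite DE !bil !scalerDr !scalerA -addrA.
- rewrite -[X in X + _]scale1r; congr (_ *: _ + (_ *: _ + _ *: _)).
    by case: (p i); case: (p j); simp_signs.
  by rewrite mulrN1.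
- congr (_ *: _ + (_ *: _ + _ *: _)).
    by case: (p i); case: (p j); simp_signs.
  by rewrite mulrN1 opprK.
congr (_ *: _ + (_ *: _ + _ *: _)).
  by case: (p i); case: (p j); simp_signs.
by rewrite mulrN1.
Qed.

(** Projects the first factor to [A] and evaluates the [V*]-components of the other
    two on basis vectors; it kills the tensors in which a factor from [A] stands
    in second or third position. *)
Definition eval_last_two (k l : 'I_n) : 'Hom(tens (tens L L) L, A) :=
  linfun (tens_lift (fun (s : tens L L) (z : L) =>
    (z.2 : 'Hom(V, K^o)) (e l) *:
      tens_lift (fun x y : L => (y.2 : 'Hom(V, K^o)) (e k) *: x.1) s)).

Lemma eval_last_twoE k l x y z :
  eval_last_two k l (x \ox y \ox z) =
    ((z.2 : 'Hom(V, K^o)) (e l) * (y.2 : 'Hom(V, K^o)) (e k)) *: x.1.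
Proof.
pose G (x y : L) := (y.2 : 'Hom(V, K^o)) (e k) *: x.1.
have Gb : is_bilinear G.
  split=> [v | u] c a b; rewrite /G /=.
    by rewrite scalerDr !scalerA mulrC.
  by rewrite !lfun_simp scalerDl scalerA.
have Gl := tens_lift_linear G.
rewrite /eval_last_two linfunE; last exact: tens_lift_linear.
rewrite tens_liftE ?tens_liftE ?scalerA //.
split=> [v | u] c a b /=.
  by rewrite Gl scalerDr !scalerA mulrC.
by rewrite !lfun_simp scalerDl scalerA.
Qed.

(** The defect depends on parities, so it is its extension [homext] that is bilinear
    on all of [V] and can be tested on a basis. *)
Lemma super_O_operator_basisE :
  super_O_operator br rho T <-> forall i j, D i j = 0.
Proof.
have bil_defect a b : is_bilinear (defect a b).
  have distr k s (x x' y y' z z' : V) (u u' : A) :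
      x = k *: y + z -> x' = k *: y' + z' ->
      k *: u + u' - T (x - s *: x') =
      k *: (u - T (y - s *: y')) + (u' - T (z - s *: z')).
    move=> -> ->; have -> : k *: y + z - s *: (k *: y' + z') =
        k *: (y - s *: y') + (z - s *: z').
      by rewrite scalerDr opprD addrACA scalerBr !scalerA mulrC.
    by rewrite [T _]linearP opprD addrACA -scalerBr.
  split=> z k u v; rewrite /defect [T (_ + _)]linearP.
    by rewrite [br _]linearP !lfun_simp; apply: distr; rewrite ?linearP ?lfun_simp.
  by rewrite [br _ _]linearP; apply: distr; rewrite ?linearP ?lfun_simp.
split=> [[_ TO] i j | D0].
  by rewrite /D /defect (TO (p i) (p j)) ?subrr ?basis_vect_mem.
split=> // a b x y xa yb; apply/eqP; rewrite -subr_eq0; apply/eqP.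
rewrite -/(defect a b x y) -(homextE bil_defect xa yb).
apply: (bilinear_basis_eq0 (homext_bilinear bil_defect) w_basis.1) => i j.
have [wi wj] := (basis_vect_mem w_basis i, basis_vect_mem w_basis j).
exact: etrans (homextE bil_defect wi wj) (D0 i j).
Qed.

End YangBaxterExpansion.

(** * O-operators and solutions of the Yang-Baxter equation *)

Theorem theorem4p2 (K : closedFieldType) (charK0 : [pchar K] =i pred0)
    (A : superspace K) (br : 'Hom(A, 'End(A)))
    (A_malcev : malcev_superalgebra br)
    (V : superspace K) (rho : 'Hom(A, 'End(V)))
    (rho_repr : representation br rho)
    (T : 'Hom(V, A)) (T_even : even_map T)
    (n : nat) (w : n.-tuple V) (w_basis : homogeneous_basis w) :
  let r := map_tensor w T - flip (map_tensor w T) in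
  super_O_operator br rho T <->
  skew_supersymmetric r /\ super_malcev_YBE (semidirect_br br rho) r.
Proof.
move=> r; have rho_even := repr_even rho_repr.
have dec := skew_decomposition T_even w_basis.
have inA0 : inA V 0 = 0 :> dsum A (dual V) by [].
have yb := YBE_defect br rho_even T_even w_basis.
apply: (iff_trans (super_O_operator_basisE br rho T_even w_basis));
  split=> [D0 | [_ [_ YB]] k l].
  split; first exact: skew_map_tensor.
  split=> [|m q x y dec']; first by do 4 eexists; exact: dec.
  rewrite (YBE_decomposition_indep _ dec' dec) yb.
  rewrite !big1 ?addr0 // => i _; rewrite big1 // => j _;
    by rewrite D0 inA0 ?(tens0l, tens0r) scaler0.
(* Evaluation at [e_k] and [e_l] leaves only the coefficient of [f_k] and [f_l]. *)
have := congr1 (eval_last_two A w k l) (etrans (esym yb) (YB _ _ _ _ dec)).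
rewrite !linearD linear0 !linear_sum.
rewrite [X in _ + X + _]big1 => [|i _]; last first.
  rewrite linear_sum big1 // => j _.
  by rewrite linearZ /= eval_last_twoE !scaler0.
rewrite [X in _ + X]big1 => [|i _]; last first.
  rewrite linear_sum big1 // => j _.
  by rewrite linearZ /= eval_last_twoE !scaler0.
rewrite !addr0 (bigD1 k) //= [X in _ + X]big1 => [|i ik]; last first.
  rewrite linear_sum big1 // => j _.
  rewrite linearZ /= eval_last_twoE /=.
  by rewrite (dual_basis_vectE i k w_basis) (negPf ik) mulr0 scale0r scaler0.
rewrite linear_sum (bigD1 l) //= big1 => [|j jl]; last first.
  rewrite linearZ /= eval_last_twoE /=.
  by rewrite (dual_basis_vectE j l w_basis) (negPf jl) mul0r scale0r scaler0.
rewrite linearZ /= eval_last_twoE /= !dual_basis_vectE // !eqxx mulr1 scale1r.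
rewrite !addr0 => /eqP; rewrite scaler_eq0 signr_eq0 => /eqP.
by [].
Qed.
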